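(* Let $P,Q\in\mathbb{F}_{q^r}[X,\sigma]$ be two monic polynomials. Let $\Gamma_P$ (resp. $\Gamma_Q$) be the companion matrix of $P$ (resp. $Q$). Then $P$ and $Q$ are similar if and only if the matrices $\Gamma_P\,\sigma(\Gamma_P)\cdots\sigma^{r-1}(\Gamma_P)$ and $\Gamma_Q\,\sigma(\Gamma_Q)\cdots\sigma^{r-1}(\Gamma_Q)$ are conjugate.
   Context: Let $p$ be a prime, $q=p^a$, $r\ge1$, $\sigma(x)=x^q$ on $\mathbb{F}_{q^r}$, acting entrywise on matrices. $\mathbb{F}_{q^r}[X,\sigma]$ is the skew polynomial ring with $X\cdot c=\sigma(c)\cdot X$ for $c\in\mathbb{F}_{q^r}$. The companion matrix of monic $P=X^d-\sum_{i=0}^{d-1}a_iX^i$ is the $d\times d$ matrix whose $j$-th column is the standard basis vector $\epsilon_{j+1}$ for $1\le j\le d-1$ and whose last column is $(a_0,\dots,a_{d-1})^T$. $A$ is a right-divisor of $B$ (and $B$ a left-multiple of $A$) if $B=UA$ for some skew polynomial $U$; rgcd and llcm denote right greatest common divisor and left lowest common multiple. Two skew polynomials $P,Q$ are similar if there exists $U$ such that the rgcd of $U$ and $P$ is $1$ and $QU$ is the llcm of $U$ and $P$. Conjugate means conjugate by an invertible matrix over $\mathbb{F}_{q^r}$. *)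

(* Defs.v *)
From HB Require Import structures.
From mathcomp Require Import all_boot all_order all_algebra all_field.

Set Implicit Arguments.
Unset Strict Implicit.
Unset Printing Implicit Defensive.

Import GRing.Theory.
Local Open Scope ring_scope.

(* The skew polynomial ring R[X, sigma], with X * c = sigma c * X.  Its
   elements are polynomials with coefficients written on the left, so that
   degrees, coefficients and monicity are those of {poly R}; only the product
   is changed.  Since skew_poly sigma is convertible to {poly R}, the type of
   the operands decides which product "*" stands for. *)
Definition skew_poly (R : nzRingType) (sigma : {rmorphism R -> R}) : Type :=
  {poly R}.

Section SkewPolyRing.

Variables (R : nzRingType) (sigma : {rmorphism R -> R}).
Implicit Types p q r : {poly R}.

(* Left multiplication by X: X * (\sum_i c_i X^i) = \sum_i sigma c_i X^(i+1). *)
Definition skew_mulX p : {poly R} := map_poly sigma p * 'X.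

(* (\sum_i c_i X^i) * q = \sum_i c_i (X^i * q). *)
Definition skew_mul p q : {poly R} :=
  \sum_(i < size p) p`_i *: iter i skew_mulX q.

Fact skew_mulX_is_additive : zmod_morphism skew_mulX.
Proof. by move=> p q; rewrite /skew_mulX rmorphB mulrBl. Qed.

HB.instance Definition _ :=
  GRing.isZmodMorphism.Build {poly R} {poly R} skew_mulX skew_mulX_is_additive.

Fact iter_skew_mulXB i : {morph iter i skew_mulX : p q / p - q}.
Proof. by elim: i => [//|i IHi] p q; rewrite /= IHi raddfB. Qed.

HB.instance Definition _ i :=
  GRing.isZmodMorphism.Build {poly R} {poly R} (iter i skew_mulX)
    (@iter_skew_mulXB i).

Fact iter_skew_mulXZ i c p :
  iter i skew_mulX (c *: p) = iter i sigma c *: iter i skew_mulX p.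
Proof.
elim: i => //= i ->; rewrite /skew_mulX -!mul_polyC rmorphM /= map_polyC.
by rewrite mulrA.
Qed.

Fact iter_skew_mulX1 i : iter i skew_mulX 1 = 'X^i.
Proof.
elim: i => [|i IHi] /=; first by rewrite expr0.
by rewrite IHi /skew_mulX map_polyXn exprSr.
Qed.

Fact skew_mulE n p q : (size p <= n)%N ->
  skew_mul p q = \sum_(i < n) p`_i *: iter i skew_mulX q.
Proof.
move=> le_p_n; rewrite /skew_mul [RHS](bigID (fun i : 'I_n => i < size p)%N) /=.
rewrite [X in _ + X]big1 ?addr0; last first.
  by move=> i; rewrite -leqNgt => /(nth_default 0) ->; rewrite scale0r.
by rewrite (big_ord_widen n (fun i => p`_i *: iter i skew_mulX q)).
Qed.

Fact skew_mulDl : left_distributive skew_mul +%R.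
Proof.
move=> p q r; pose n := maxn (size (p + q)) (maxn (size p) (size q)).
rewrite !(@skew_mulE n) ?leq_max ?leqnn ?orbT // -big_split /=.
by apply: eq_bigr => i _; rewrite coefD scalerDl.
Qed.

Fact skew_mulDr : right_distributive skew_mul +%R.
Proof.
move=> p q r; rewrite /skew_mul -big_split /=.
by apply: eq_bigr => i _; rewrite raddfD scalerDr.
Qed.

Fact skew_mul0l q : skew_mul 0 q = 0.
Proof. by rewrite /skew_mul size_poly0 big_ord0. Qed.

Fact skew_mul_suml n (F : 'I_n -> {poly R}) q :
  skew_mul (\sum_i F i) q = \sum_i skew_mul (F i) q.
Proof.
by apply: (big_morph (skew_mul^~ q)) => [p r|];
  rewrite ?skew_mulDl ?skew_mul0l.
Qed.

Fact skew_mul_monl c i q : skew_mul (c *: 'X^i) q = c *: iter i skew_mulX q.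
Proof.
rewrite (@skew_mulE i.+1); last first.
  by rewrite (leq_trans (size_scale_leq _ _)) // size_polyXn.
rewrite big_ord_recr /= big1 => [|j _].
  by rewrite add0r coefZ coefXn eqxx mulr1.
by rewrite coefZ coefXn ltn_eqF ?ltn_ord // mulr0 scale0r.
Qed.

Fact skew_mul1l : left_id 1 skew_mul.
Proof. by move=> q; have := skew_mul_monl 1 0 q; rewrite expr0 !scale1r. Qed.

Fact skew_mulr1 : right_id 1 skew_mul.
Proof.
move=> p; rewrite /skew_mul -[RHS]coefK poly_def.
by apply: eq_bigr => i _; rewrite iter_skew_mulX1.
Qed.

Fact skew_mulA : associative skew_mul.
Proof.
move=> p q r; rewrite [skew_mul p q]/skew_mul skew_mul_suml.
rewrite [LHS]/skew_mul; apply: eq_bigr => i _.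
have iter_q : iter i skew_mulX q
    = \sum_(j < size q) iter i sigma q`_j *: 'X^(i + j).
  rewrite -{1}[q]coefK poly_def raddf_sum /=; apply: eq_bigr => j _.
  by rewrite iter_skew_mulXZ -(iter_skew_mulX1 j) -iterD iter_skew_mulX1.
rewrite iter_q scaler_sumr skew_mul_suml raddf_sum scaler_sumr /=.
apply: eq_bigr => j _.
by rewrite scalerA skew_mul_monl iter_skew_mulXZ -iterD scalerA.
Qed.

HB.instance Definition _ := GRing.Zmodule.on (skew_poly sigma).
HB.instance Definition _ :=
  GRing.Zmodule_isNzRing.Build (skew_poly sigma)
    skew_mulA skew_mul1l skew_mulr1 skew_mulDl skew_mulDr (oner_neq0 {poly R}).

Lemma skew_poly_mulXC (c : R) :
  ('X : skew_poly sigma) * (c%:P : skew_poly sigma)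
  = ((sigma c)%:P : skew_poly sigma) * ('X : skew_poly sigma).
Proof.
rewrite -[LHS]/(skew_mul 'X c%:P) -[RHS]/(skew_mul (sigma c)%:P 'X).
have := skew_mul_monl 1 1 c%:P; rewrite scale1r expr1 => ->.
have := skew_mul_monl (sigma c) 0 'X; rewrite expr0 alg_polyC => -> /=.
by rewrite scale1r /skew_mulX map_polyC mul_polyC.
Qed.

End SkewPolyRing.

Section Divisibility.

Variable A : nzRingType.
Implicit Types a b d g m u p q : A.

Definition right_divides a b : Prop := exists u, b = u * a.

Definition is_rgcd g a b : Prop :=
  [/\ right_divides g a, right_divides g b
    & forall d, right_divides d a -> right_divides d b -> right_divides d g].

(* As a common left multiple of lowest degree, an llcm is nonzero by
   definition; it is determined up to a unit on the left.  Allowing m = 0 would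
   make 1 similar to every q below, through u = 0. *)
Definition is_llcm m a b : Prop :=
  [/\ m != 0, right_divides a m, right_divides b m
    & forall n, right_divides a n -> right_divides b n -> right_divides m n].

Definition skew_similar p q : Prop :=
  exists u, is_rgcd 1 u p /\ is_llcm (q * u) u p.

End Divisibility.

(* For monic P = X^d - \sum_(i < d) a_i X^i, the library's companionmx P is the
   row version, whose last row is (a_0, ..., a_(d-1)); the transpose has
   j-th column e_(j+1) and last column (a_0, ..., a_(d-1))^T. *)
Definition skew_companion (R : nzRingType) (P : {poly R}) :
  'M[R]_((size P).-1) := (companionmx P)^T.

Definition sigma_norm (R : nzRingType) (sigma : {rmorphism R -> R}) (r n : nat)
  (M : 'M[R]_n) : 'M[R]_n := \prod_(i < r) map_mx (iter i sigma) M.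

(* Matrices of different sizes are not conjugate. *)
Definition mx_conjugate (F : fieldType) (m n : nat) (M : 'M[F]_m) (N : 'M[F]_n)
  : Prop := exists e : m = n, castmx (e, e) M ~_{in unitmx} N.

(* Main.v *)
Require Import Defs.
From HB Require Import structures.
From mathcomp Require Import all_boot all_order all_algebra all_field.
From mathcomp Require Import cyclic.

(* Write S for the skew polynomial ring.  S/SP is 'rV_d with X acting by
   v |-> sigma v *m G, G being the companion matrix of P acting on rows, and X^r
   acts linearly by the (transposed) norm of G.  P and Q are similar if and only
   if S/SP and S/SQ are isomorphic, so the point is that an isomorphism of
   F[X^r]-modules between them yields one of S-modules.

   Writing P = P1 X^e with P1(0) != 0 splits S/SP as S/SX^e + S/SP1.  The first
   summand is determined by its dimension e and the norm is nilpotent on it and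
   invertible on the second, so one may assume that X is invertible.  Then, for
   S-modules M and L, X acts semilinearly by conjugation on Hom_{F[X^r]}(M, L),
   with fixed points Hom_S(M, L); by Galois descent
   |Hom_{F[X^r]}(M, L)| = |Hom_S(M, L)|^r.  Hence if M and M' are isomorphic
   over F[X^r], then |Hom_S(M, L)| = |Hom_S(M', L)| for every submodule L of M'.
   Induction on L gives the same equality for surjections, and for L = M' the
   identity of M' provides a surjection, hence an isomorphism, M -> M'. *)

Set Implicit Arguments.
Unset Strict Implicit.
Unset Printing Implicit Defensive.

Import GRing.Theory.
Local Open Scope ring_scope.

(** * Arithmetic of skew polynomials *)

Section SkewArithmetic.

Variables (F : fieldType) (sigma : {rmorphism F -> F}).
Local Notation S := (skew_poly sigma).
Implicit Types (p q u v : S) (c : F) (k i : nat).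

Lemma iter_rmorph_eq0 k c : (iter k sigma c == 0) = (c == 0).
Proof. by elim: k => //= k IHk; rewrite fmorph_eq0. Qed.

Lemma iter_rmorph0 k : iter k sigma 0 = 0.
Proof. by apply/eqP; rewrite iter_rmorph_eq0. Qed.

Lemma coef_skew_mulX (p : {poly F}) i :
  (skew_mulX sigma p)`_i = if i == 0 then 0 else sigma p`_i.-1.
Proof. by rewrite coefMX coef_map. Qed.

Lemma coef_iter_skew_mulX k (p : {poly F}) i :
  (iter k (skew_mulX sigma) p)`_i
  = if (i < k)%N then 0 else iter k sigma p`_(i - k).
Proof.
elim: k i => [|k IHk] i /=; first by rewrite subn0.
rewrite coef_skew_mulX; case: i => [|i] //=.
by rewrite IHk ltnS subSS; case: ifP; rewrite ?rmorph0.
Qed.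

Lemma size_iter_skew_mulX k (p : {poly F}) :
  (size (iter k (skew_mulX sigma) p) <= k + size p)%N.
Proof.
apply/leq_sizeP => i le_i; rewrite coef_iter_skew_mulX; case: ltnP => // le_ki.
by rewrite nth_default ?iter_rmorph0 // leq_subRL.
Qed.

Lemma coef_skew_mul (p q : S) k :
  (p * q : S)`_k = \sum_(i < k.+1) p`_i * iter i sigma q`_(k - i).
Proof.
rewrite -[p * q]/(skew_mul sigma p q).
rewrite (@skew_mulE _ _ (maxn (size (p : {poly F})) k.+1)) ?leq_maxl //.
rewrite coef_sum [RHS](big_ord_widen (maxn (size (p : {poly F})) k.+1)
   (fun i => p`_i * iter i sigma q`_(k - i))) ?leq_maxr //.
rewrite [RHS]big_mkcond; apply: eq_bigr => i _ /=.
by rewrite coefZ coef_iter_skew_mulX ltnS ltnNge; case: leqP; rewrite ?mulr0.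
Qed.

(** The top coefficient of the product is [lead_coef p] times an iterate of [sigma] at
    [lead_coef q], and [sigma] is injective. *)
Lemma skew_mul_neq0 (p q : S) : p != 0 -> q != 0 -> p * q != 0.
Proof.
move=> nz_p nz_q.
have [m sz_p] : exists m, size (p : {poly F}) = m.+1.
  by move: nz_p; rewrite -size_poly_gt0; case: size => // m; exists m.
have [n sz_q] : exists n, size (q : {poly F}) = n.+1.
  by move: nz_q; rewrite -size_poly_gt0; case: size => // n; exists n.
apply: contra_neq (_ : (p * q : S)`_(m + n) != 0) => [->|]; first exact: coef0.
rewrite coef_skew_mul (bigD1 (inord m)) //= inordK ?ltnS ?leq_addr //.
rewrite big1 ?addr0 => [|i ne_i].
  rewrite addKn mulf_neq0 ?iter_rmorph_eq0 //.
    by rewrite -[m]/(m.+1.-1) -sz_p -lead_coefE lead_coef_eq0.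
  by rewrite -[n]/(n.+1.-1) -sz_q -lead_coefE lead_coef_eq0.
have [lt_im|le_mi] := ltnP i m.
  rewrite [q`_ _]nth_default ?iter_rmorph0 ?mulr0 // sz_q.
  by rewrite ltn_subRL ltn_add2r.
rewrite [p`_ _]nth_default ?mul0r // sz_p ltn_neqAle le_mi andbT.
apply: contraNneq ne_i => eq_mi; apply/eqP/val_inj.
by rewrite /= inordK ?ltnS ?leq_addr //.
Qed.

Lemma skew_mulIf (p q u : S) : u != 0 -> p * u = q * u -> p = q.
Proof.
move=> nz_u eq_pq; apply/eqP; rewrite -subr_eq0.
have: (p - q) * u == 0 by rewrite mulrBl eq_pq subrr.
by apply: contraTT => /skew_mul_neq0-/(_ u nz_u).
Qed.

Lemma skew_divp (u p : S) : p != 0 ->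
  exists q r : S,
    u = q * p + r /\ (size (r : {poly F}) < size (p : {poly F}))%N.
Proof.
move=> nz_p; have [n le_un] := ubnP (size (u : {poly F})).
elim: n u le_un => // n IHn u /ltnSE le_un.
have [lt_up|le_pu] := ltnP (size (u : {poly F})) (size (p : {poly F})).
  by exists 0, u; rewrite mul0r add0r.
have gt0_p : (0 < size (p : {poly F}))%N by rewrite size_poly_gt0.
pose k := (size (u : {poly F}) - size (p : {poly F}))%N.
(* [X^k p] has leading coefficient [sigma^k (lead_coef p)], so [t * p] has the leading term of
   [u]. *)
pose c := lead_coef (u : {poly F}) / iter k sigma (lead_coef (p : {poly F})).
pose t : S := c *: ('X^k : {poly F}).
have tpE : (t * p : S) = c *: iter k (skew_mulX sigma) p.
  exact: skew_mul_monl.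
have lt_u' : (size ((u - t * p)%R : {poly F}) < size (u : {poly F}))%N.
  have u_gt0 : (0 < size (u : {poly F}))%N by apply: leq_trans le_pu.
  rewrite -[X in (_ < X)%N](prednK u_gt0) ltnS; apply/leq_sizeP => i le_i.
  rewrite coefB tpE coefZ coef_iter_skew_mulX.
  have le_ki : (k <= i)%N.
    apply: leq_trans le_i; rewrite /k -subn1 leq_sub2l //.
  rewrite ltnNge le_ki /=.
  have := le_i; rewrite leq_eqVlt => /predU1P[eq_i|lt_i].
    have -> : (i - k = (size (p : {poly F})).-1)%N.
      rewrite -eq_i /k -subn1 -subnDA addnC subnDA subKn ?subn1 //.
    rewrite -lead_coefE -eq_i -lead_coefE divfK ?subrr //.
    by rewrite iter_rmorph_eq0 lead_coef_eq0.
  have le_ui : (size (u : {poly F}) <= i)%N by rewrite -(prednK u_gt0).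
  rewrite nth_default // [p`_ _]nth_default ?iter_rmorph0 ?mulr0 ?subr0 //.
  by rewrite leq_subRL // /k subnK.
have [//|q [r [u'E lt_r]]] := IHn (u - t * p); first exact: leq_trans lt_u' _.
by exists (q + t), r; rewrite mulrDl addrAC -u'E subrK.
Qed.

(** Euclid's algorithm, [(u, p)] becoming [(p, r)]; quotients, hence Bezout coefficients, stand on
    the left. *)
Lemma skew_bezout (u p : S) : exists g a b : S,
  [/\ g = a * u + b * p, right_divides g u & right_divides g p].
Proof.
have [n] := ubnP (size (p : {poly F})).
elim: n u p => // n IHn u p /ltnSE le_pn.
have [->|nz_p] := eqVneq p 0.
  exists u, 1, 0; rewrite mul1r mul0r addr0.
  split=> //; first by exists 1; rewrite mul1r.
  by exists 0; rewrite mul0r.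
have [q [r [uE lt_rp]]] := skew_divp u nz_p.
have [|g [a [b [gE g_p [s rE]]]]] := IHn p r; first exact: leq_trans lt_rp _.
case: g_p => t pE; exists g, b, (a - b * q); split.
- by rewrite gE uE mulrDr mulrBl mulrA [RHS]addrC addrA subrK.
- by exists (q * t + s); rewrite mulrDl -mulrA -pE -rE.
- by exists t.
Qed.

End SkewArithmetic.

(** * Row spaces as modules over the skew polynomials *)

Section SemilinearAction.

Variables (F : fieldType) (sigma : {rmorphism F -> F}).
Local Notation S := (skew_poly sigma).

Definition semilin m n (G : 'M[F]_n) (v : 'M[F]_(m, n)) : 'M[F]_(m, n) :=
  map_mx sigma v *m G.

(* The left module structure on 'rV_n for which X acts as semilin G. *)
Definition skew_act n (G : 'M[F]_n) (p : {poly F}) (v : 'rV[F]_n) : 'rV[F]_n :=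
  \sum_(i < size p) p`_i *: iter i (semilin G) v.

(** In row convention, [v |-> v *m A] commutes with the actions of [X]; for [sigma = idfun] this is
    [G *m A = A *m G']. *)
Definition skew_intertwines m n (G : 'M[F]_m) (G' : 'M[F]_n) (A : 'M[F]_(m, n))
  := G *m A = map_mx sigma A *m G'.

(** [A] may be rectangular, so that modules of a priori different dimensions are compared without
    casts. *)
Definition semi_iso m n (G : 'M[F]_m) (G' : 'M[F]_n) := exists A B,
  [/\ A *m B = 1%:M, B *m A = 1%:M & skew_intertwines G G' A].

Lemma semilinD m n (G : 'M[F]_n) : {morph @semilin m n G : u v / u + v}.
Proof. by move=> u v; rewrite /semilin map_mxD mulmxDl. Qed.

Lemma semilinZ m n (G : 'M[F]_n) c (v : 'M_(m, n)) :
  semilin G (c *: v) = sigma c *: semilin G v.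
Proof. by rewrite /semilin map_mxZ scalemxAl. Qed.

Lemma semilin0 m n (G : 'M[F]_n) : semilin G 0 = 0 :> 'M_(m, n).
Proof. by rewrite /semilin map_mx0 mul0mx. Qed.

Lemma iter_semilin0 m n (G : 'M[F]_n) i :
  iter i (semilin G) 0 = 0 :> 'M_(m, n).
Proof. by elim: i => //= i ->; rewrite semilin0. Qed.

Lemma skew_act_widen k n (G : 'M[F]_n) (p : {poly F}) v : (size p <= k)%N ->
  skew_act G p v = \sum_(i < k) p`_i *: iter i (semilin G) v.
Proof.
move=> le_p_k; rewrite /skew_act.
rewrite (big_ord_widen k (fun i => p`_i *: iter i (semilin G) v)) //.
rewrite big_mkcond; apply: eq_bigr => i _ /=.
by case: ltnP => // /(nth_default 0) ->; rewrite scale0r.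
Qed.

Lemma skew_act0l n (G : 'M[F]_n) v : skew_act G 0 v = 0.
Proof. by rewrite /skew_act size_poly0 big_ord0. Qed.

Lemma skew_act0r n (G : 'M[F]_n) p : skew_act G p 0 = 0.
Proof. by rewrite /skew_act big1 // => i _; rewrite iter_semilin0 scaler0. Qed.

Lemma skew_actDl n (G : 'M[F]_n) (p q : {poly F}) v :
  skew_act G (p + q) v = skew_act G p v + skew_act G q v.
Proof.
pose k := maxn (size (p + q)) (maxn (size p) (size q)).
rewrite !(@skew_act_widen k) ?leq_max ?leqnn ?orbT // -big_split /=.
by apply: eq_bigr => i _; rewrite coefD scalerDl.
Qed.

Lemma skew_actZl n (G : 'M[F]_n) c (p : {poly F}) v :
  skew_act G (c *: p) v = c *: skew_act G p v.
Proof.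
rewrite (@skew_act_widen (size p)) ?size_scale_leq // scaler_sumr.
by apply: eq_bigr => i _; rewrite coefZ scalerA.
Qed.

Lemma skew_actNl n (G : 'M[F]_n) (p : {poly F}) v :
  skew_act G (- p) v = - skew_act G p v.
Proof. by rewrite -scaleN1r skew_actZl scaleN1r. Qed.

Lemma skew_act_suml n (G : 'M[F]_n) (k : nat) (f : 'I_k -> {poly F}) v :
  skew_act G (\sum_i f i) v = \sum_i skew_act G (f i) v.
Proof.
by apply: (big_morph (fun p => skew_act G p v)) => [p q|];
  rewrite ?skew_actDl ?skew_act0l.
Qed.

Lemma skew_actXn n (G : 'M[F]_n) k v :
  skew_act G 'X^k v = iter k (semilin G) v.
Proof.
rewrite (@skew_act_widen k.+1) ?size_polyXn // big_ord_recr /= coefXn eqxx.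
rewrite scale1r big1 ?add0r // => i _.
by rewrite coefXn ltn_eqF ?ltn_ord // scale0r.
Qed.

Lemma skew_act1 n (G : 'M[F]_n) v : skew_act G 1 v = v.
Proof. by rewrite -(expr0 'X) skew_actXn. Qed.

Lemma skew_act_iter_mulX n (G : 'M[F]_n) k (p : {poly F}) v :
  skew_act G (iter k (skew_mulX sigma) p) v
  = iter k (semilin G) (skew_act G p v).
Proof.
elim: k => //= k <-; move: (iter k _ p) => {}p.
rewrite (@skew_act_widen (size p).+1); last first.
  exact: (size_iter_skew_mulX sigma 1).
rewrite big_ord_recl coef_skew_mulX scale0r add0r /skew_act.
rewrite (big_morph _ (semilinD G) (semilin0 _ G)).
by apply: eq_bigr => i _; rewrite coef_skew_mulX semilinZ.
Qed.

Lemma skew_actM n (G : 'M[F]_n) (p q : S) v :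
  skew_act G (p * q : S) v = skew_act G p (skew_act G q v).
Proof.
rewrite -[p * q]/(skew_mul sigma p q) /skew_mul skew_act_suml.
by apply: eq_bigr => i _; rewrite skew_actZl skew_act_iter_mulX.
Qed.

Lemma iter_semilin_mul l m n (G : 'M[F]_m) (G' : 'M[F]_n) A k (v : 'M_(l, m)) :
  skew_intertwines G G' A ->
  iter k (semilin G) v *m A = iter k (semilin G') (v *m A).
Proof.
move=> GA; elim: k => //= k <-.
by rewrite /semilin map_mxM -!mulmxA GA.
Qed.

Lemma skew_act_mul m n (G : 'M[F]_m) (G' : 'M[F]_n) A p v :
  skew_intertwines G G' A -> skew_act G p v *m A = skew_act G' p (v *m A).
Proof.
move=> GA; rewrite /skew_act mulmx_suml; apply: eq_bigr => i _.
by rewrite -scalemxAl (iter_semilin_mul _ _ GA).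
Qed.

Lemma skew_intertwines1 n (G : 'M[F]_n) : skew_intertwines G G 1%:M.
Proof. by rewrite /skew_intertwines map_mx1 mulmx1 mul1mx. Qed.

Lemma skew_intertwinesM m n k (G1 : 'M[F]_m) (G2 : 'M[F]_n) (G3 : 'M[F]_k) A B :
  skew_intertwines G1 G2 A -> skew_intertwines G2 G3 B ->
  skew_intertwines G1 G3 (A *m B).
Proof.
by move=> A12 B23; rewrite /skew_intertwines map_mxM mulmxA A12 -!mulmxA B23.
Qed.

Lemma semi_iso_refl n (G : 'M[F]_n) : semi_iso G G.
Proof.
by exists 1%:M, 1%:M; split; rewrite ?mulmx1 //; apply: skew_intertwines1.
Qed.

Lemma semi_iso_sym m n (G : 'M[F]_m) (G' : 'M[F]_n) :
  semi_iso G G' -> semi_iso G' G.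
Proof.
case=> A [B [AB BA GA]]; exists B, A; split=> //.
rewrite /skew_intertwines -[G']mul1mx -(map_mx1 sigma) -BA map_mxM.
by rewrite -[_ *m G']mulmxA -GA -!mulmxA AB mulmx1.
Qed.

Lemma semi_iso_trans m n k (G1 : 'M[F]_m) (G2 : 'M[F]_n) (G3 : 'M[F]_k) :
  semi_iso G1 G2 -> semi_iso G2 G3 -> semi_iso G1 G3.
Proof.
case=> A [B [AB BA GA]] [A' [B' [AB' BA' GA']]].
exists (A *m A'), (B' *m B); split; last exact: skew_intertwinesM GA GA'.
  by rewrite mulmxA -(mulmxA A) AB' mulmx1.
by rewrite mulmxA -(mulmxA B') BA mulmx1.
Qed.

(** Injectivity gives [m <= n], so [A] is square with free rows, hence invertible. *)
Lemma semi_iso_of_free m n (G : 'M[F]_m) (G' : 'M[F]_n) A :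
  skew_intertwines G G' A -> (n <= m)%N ->
  (forall v : 'rV_m, v *m A = 0 -> v = 0) ->
  semi_iso G G'.
Proof.
move=> GA le_nm /inj_row_free Afree.
have eq_mn : m = n.
  by apply/eqP; rewrite eqn_leq le_nm -(eqP Afree) rank_leq_col.
subst n; exists A, (invmx A).
by rewrite row_free_unit in Afree; rewrite mulmxV // mulVmx.
Qed.

End SemilinearAction.

(** * Companion matrices and similarity *)

Section Companion.

Variables (F : fieldType) (sigma : {rmorphism F -> F}).
Local Notation S := (skew_poly sigma).
Local Notation act := (@skew_act F sigma _).

Lemma rV0_eq n (u v : 'rV[F]_n) : n = 0 -> u = v.
Proof. by move=> n0; apply/rowP=> -[i lt_in]; exfalso; rewrite n0 in lt_in. Qed.

(** Below degree [d], [X] shifts the standard basis vectors, which [sigma] fixes. *)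
Lemma iter_semilin_companion (P : {poly F}) i : (i < (size P).-1)%N ->
  iter i (semilin sigma (companionmx P)) (poly_rV 1)
  = poly_rV 'X^i.
Proof.
have polyXn j (lt_j : (j < (size P).-1)%N) :
    poly_rV 'X^j = 'e_(Ordinal lt_j) :> 'rV[F]_((size P).-1).
  by apply/rowP=> k; rewrite !mxE coefXn eqxx.
elim: i => [|i IHi] lt_i /=; first by rewrite expr0.
rewrite IHi ?(ltnW lt_i) // polyXn; first exact: ltnW.
move=> lt_i'; rewrite /semilin map_delta_mx.
by rewrite (mulmx_delta_companion (i := Ordinal lt_i') lt_i) -polyXn.
Qed.

Variables (P : S) (P_monic : (P : {poly F}) \is monic).
Local Notation d := (size (P : {poly F})).-1.
Local Notation G := (companionmx (P : {poly F})).
Local Notation one := (poly_rV (1 : {poly F}) : 'rV[F]_d).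

(** The class of 1 generates: each vector is the class of the polynomial of degree below [d] that it
    encodes. *)
Lemma skew_act_rVpoly (v : 'rV[F]_d) : act G (rVpoly v) one = v.
Proof.
rewrite (@skew_act_widen _ _ d) ?size_poly //.
rewrite [RHS]row_sum_delta; apply: eq_bigr => i _.
rewrite coef_rVpoly_ord iter_semilin_companion //; congr (_ *: _).
by apply/rowP=> k; rewrite !mxE coefXn eqxx.
Qed.

Lemma skew_act_companion : act G P one = 0.
Proof.
have [d0|d_gt0] := posnP d; first exact: rV0_eq.
have szP : size (P : {poly F}) = d.+1.
  by rewrite prednK // size_poly_gt0 monic_neq0.
rewrite (@skew_act_widen _ _ d.+1); last by rewrite -szP.
rewrite big_ord_recr /=.
have -> : (P : {poly F})`_d = 1 by exact: (monicP P_monic).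
(* [poly_rV P] drops the leading coefficient; its opposite is the last row of [G]. *)
have -> : iter d (semilin sigma G) one = - poly_rV P.
  have lt_d : (d.-1 < d)%N by rewrite prednK.
  rewrite -[X in iter X](prednK d_gt0) /= iter_semilin_companion //.
  have -> : poly_rV 'X^(d.-1) = 'e_(Ordinal lt_d) :> 'rV[F]_d.
    by apply/rowP=> k; rewrite !mxE coefXn eqxx.
  rewrite /semilin map_delta_mx -rowE; apply/rowP=> k.
  by rewrite !mxE /= eqxx.
rewrite scale1r; apply/eqP; rewrite subr_eq0; apply/eqP.
rewrite [RHS]row_sum_delta; apply: eq_bigr => i _.
rewrite iter_semilin_companion // mxE; congr (_ *: _).
by apply/rowP=> k; rewrite !mxE coefXn eqxx.
Qed.

(** The annihilator of the class of 1 is [S P], which identifies the module with [S / S P]: a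
    remainder of degree below [d] is determined by its class. *)
Lemma skew_act_one_eq0 (V : S) : act G V one = 0 <-> right_divides P V.
Proof.
split=> [V0|[q ->]]; last by rewrite skew_actM skew_act_companion skew_act0r.
have nzP : P != 0 by rewrite monic_neq0.
have [q [r [VE lt_r]]] := skew_divp V nzP.
have le_r : (size (r : {poly F}) <= d)%N.
  by rewrite -ltnS prednK // size_poly_gt0 monic_neq0.
have r0 : poly_rV (r : {poly F}) = 0 :> 'rV[F]_d.
  rewrite -V0 VE skew_actDl skew_actM skew_act_companion skew_act0r add0r.
  by rewrite -[in RHS](poly_rV_K le_r) skew_act_rVpoly.
by exists q; rewrite VE -[r](poly_rV_K le_r) r0 linear0 addr0.
Qed.

(** When [P] kills [w], this is the matrix of the morphism from [S / S P] sending the class of 1 to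
    [w]. *)
Definition krylov n (G' : 'M[F]_n) (w : 'rV[F]_n) : 'M[F]_(d, n) :=
  \matrix_(i < d) iter i (semilin sigma G') w.

Lemma mul_krylov n (G' : 'M[F]_n) w v :
  v *m krylov G' w = act G' (rVpoly v) w.
Proof.
rewrite (@skew_act_widen _ _ d) ?size_poly // mulmx_sum_row.
by apply: eq_bigr => i _; rewrite coef_rVpoly_ord rowK.
Qed.

(** Well-definedness: [V] and the reduced representative of its class differ by a left multiple of
    [P], which kills [w]. *)
Lemma mul_krylov_act n (G' : 'M[F]_n) w (V : S) : act G' P w = 0 ->
  act G V one *m krylov G' w = act G' V w.
Proof.
move=> Pw; rewrite mul_krylov; set R : S := rVpoly _.
have [q VR] : right_divides P (V - R).
  apply/skew_act_one_eq0.
  by rewrite skew_actDl skew_actNl skew_act_rVpoly subrr.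
apply/eqP; rewrite eq_sym -subr_eq0 -skew_actNl -skew_actDl.
by rewrite [X in act _ X](VR : _ = _) skew_actM Pw skew_act0r.
Qed.

Lemma krylov_intertwines n (G' : 'M[F]_n) w : act G' P w = 0 ->
  skew_intertwines sigma G G' (krylov G' w).
Proof.
move=> Pw; apply/row_matrixP=> i; rewrite !row_mul -map_row.
have -> : row i (krylov G' w) = 'e_i *m krylov G' w by rewrite -rowE.
rewrite -/(semilin sigma G' _) -[semilin _ _ _]/(iter 1 (semilin sigma G') _).
rewrite [in RHS]mul_krylov -skew_actXn expr1 -[RHS]skew_actM -mul_krylov_act //.
rewrite skew_actM skew_act_rVpoly -(expr1 'X) skew_actXn /=.
by rewrite /semilin map_delta_mx -rowE.
Qed.

End Companion.

(** * Similarity as isomorphism of cyclic modules *)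

Section Similarity.

Variables (F : fieldType) (sigma : {rmorphism F -> F}).
Local Notation S := (skew_poly sigma).
Local Notation act := (@skew_act F sigma _).
Variables (P Q : S).
Hypotheses (P_monic : (P : {poly F}) \is monic).
Hypotheses (Q_monic : (Q : {poly F}) \is monic).
Local Notation GP := (companionmx (P : {poly F})).
Local Notation GQ := (companionmx (Q : {poly F})).
Local Notation dP := (size (P : {poly F})).-1.
Local Notation dQ := (size (Q : {poly F})).-1.

(** Right multiplication by [U] maps [S / S Q] to [S / S P], because [P] right-divides [Q U]. It is
    onto because the rgcd is 1, and injective because [Q U] is the llcm. *)
Lemma skew_similar_semi_iso : skew_similar P Q -> semi_iso sigma GQ GP.
Proof.
case=> U [[_ _ gcd1] [nzQU _ [c PQU] lcmQU]].
have nzU : U != 0 by apply: contraNneq nzQU => ->; rewrite mulr0.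
pose w := act GP U (poly_rV 1).
have Qw : act GP Q w = 0.
  by rewrite -skew_actM; apply/(skew_act_one_eq0 P_monic); exists c.
have [g [a [b [gE gU gP]]]] := skew_bezout U P.
have [e gE1] := gcd1 _ gU gP.
apply: (@semi_iso_of_free _ _ _ _ _ _ (krylov Q GP w)).
- exact: krylov_intertwines.
(* Surjectivity supplies the inequality between dimensions; it follows from [1 = e a U + e b P]. *)
- suff full : (1%:M <= krylov Q GP w)%MS.
    have /mxrankS := full; rewrite mxrank1 => /leq_trans; apply.
    exact: rank_leq_row.
  apply/row_subP=> i; set u := row i _.
  rewrite -[u](@skew_act_rVpoly _ sigma P).
  have -> : rVpoly u
      = (rVpoly u : S) * e * a * U + (rVpoly u : S) * e * b * P :> S.
    by rewrite -!mulrA -!mulrDr -gE -gE1 mulr1.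
  rewrite skew_actDl [X in _ + X]skew_actM skew_act_companion // skew_act0r addr0.
  by rewrite skew_actM -(mul_krylov_act Q_monic _ Qw) submxMl.
- move=> v; rewrite mul_krylov /w -skew_actM => /(skew_act_one_eq0 P_monic) PvU.
  have [|q vU] := lcmQU _ _ PvU; first by exists (rVpoly v).
  rewrite mulrA in vU.
  rewrite -[v](@skew_act_rVpoly _ sigma Q) [X in act _ X](skew_mulIf nzU vU).
  by rewrite skew_actM skew_act_companion // skew_act0r.
Qed.

(** Conversely, [U] represents the image of the class of 1 under the isomorphism. *)
Lemma semi_iso_skew_similar : semi_iso sigma GQ GP -> skew_similar P Q.
Proof.
case=> A [B [AB BA GA]].
pose w := poly_rV 1 *m A.
(* Adding [P] keeps the class and makes [U] nonzero, even if [w] is 0, as for [P = 1]. *)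
pose U : S := rVpoly w + (P : {poly F}).
have nzU : U != 0.
  have lt_w : (size (rVpoly w) < size (P : {poly F}))%N.
    rewrite -[X in (_ < X)%N]prednK ?ltnS ?size_poly //.
    by rewrite size_poly_gt0 monic_neq0.
  by rewrite -size_poly_gt0 /U addrC size_polyDl // size_poly_gt0 monic_neq0.
have wE : act GP U (poly_rV 1) = w.
  by rewrite skew_actDl skew_act_companion // addr0 skew_act_rVpoly.
have actVw V : act GP V w = act GQ V (poly_rV 1) *m A.
  by rewrite (skew_act_mul _ _ GA).
have PVU (V : S) : right_divides P (V * U) <-> right_divides Q V.
  split=> [/(skew_act_one_eq0 P_monic)|/(skew_act_one_eq0 Q_monic) V0].
    rewrite skew_actM wE actVw => V0; apply/(skew_act_one_eq0 Q_monic).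
    by rewrite -[LHS]mulmx1 -AB mulmxA V0 mul0mx.
  by apply/(skew_act_one_eq0 P_monic); rewrite skew_actM wE actVw V0 mul0mx.
exists U; split.
  split; [by exists U; rewrite mulr1 | by exists P; rewrite mulr1 |].
  move=> e [s UE] [t PE].
  (* The preimage of the class of 1 satisfies [V U = 1] modulo [P], a Bezout relation for [U] and
     [P]. *)
  pose V : S := rVpoly ((poly_rV 1 : 'rV[F]_dP) *m B).
  have [c cE] : right_divides P (V * U - 1).
    apply/(skew_act_one_eq0 P_monic).
    rewrite skew_actDl skew_actM wE actVw skew_act_rVpoly skew_actNl skew_act1.
    by rewrite -mulmxA BA mulmx1 subrr.
  exists (V * s - c * t).
  by rewrite mulrBl -!mulrA -UE -PE -cE opprB addrC subrK.
split.
- by apply: skew_mul_neq0 nzU; apply: monic_neq0 Q_monic.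
- by exists Q.
- by apply/PVU; exists 1; rewrite mul1r.
move=> n [c ->] /PVU [k ->]; exists k; exact: esym (mulrA _ _ _).
Qed.

End Similarity.

(** * Norms and Galois descent *)

Section Norm.

Variables (F : fieldType) (sigma : {rmorphism F -> F}).

(** This is [sigma^(k-1)(G) ... sigma(G) G]: [X^k] acts by [sigma^k] on coordinates followed by this
    matrix. *)
Definition skew_norm k n (G : 'M[F]_n) : 'M[F]_n :=
  iter k (semilin sigma G) 1%:M.

Lemma iter_semilinE k m n (G : 'M[F]_n) (A : 'M[F]_(m, n)) :
  iter k (semilin sigma G) A = iter k (map_mx sigma) A *m skew_norm k G.
Proof.
elim: k => [|k IHk]; first by rewrite mulmx1.
by rewrite /= IHk /semilin map_mxM mulmxA.
Qed.

Lemma skew_normSl k n (G : 'M[F]_n) :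
  skew_norm k.+1 G = map_mx sigma (skew_norm k G) *m G.
Proof. by []. Qed.

Lemma skew_normS k n (G : 'M[F]_n) :
  skew_norm k.+1 G = iter k (map_mx sigma) G *m skew_norm k G.
Proof.
by rewrite /skew_norm iterSr {2}/semilin map_mx1 mul1mx iter_semilinE.
Qed.

Lemma map_mx_iter k m n (A : 'M[F]_(m, n)) :
  map_mx (iter k sigma) A = iter k (map_mx sigma) A.
Proof.
by elim: k => [|k IHk] /=; [rewrite map_mx_id | rewrite -IHk -map_mx_comp].
Qed.

(** Transposition reverses the order of the factors, passing from columns to rows. *)
Lemma trmx_sigma_norm k n (G : 'M[F]_n) :
  (sigma_norm sigma k G^T)^T = skew_norm k G.
Proof.
elim: k => [|k IHk]; first by rewrite /sigma_norm big_ord0 trmx1.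
rewrite skew_normS /sigma_norm big_ord_recr trmx_mul -map_trmx trmxK.
by rewrite map_mx_iter -IHk.
Qed.

Lemma skew_norm_intertwines k m n (G : 'M[F]_m) (G' : 'M[F]_n) A :
  skew_intertwines sigma G G' A ->
  skew_norm k G *m A = iter k (map_mx sigma) A *m skew_norm k G'.
Proof.
by move=> GA; rewrite /skew_norm (iter_semilin_mul _ _ GA) mul1mx iter_semilinE.
Qed.

Lemma iter_map_mx_unit k n (G : 'M[F]_n) :
  (iter k (map_mx sigma) G \in unitmx) = (G \in unitmx).
Proof. by elim: k => //= k IHk; rewrite map_unitmx. Qed.

Lemma skew_norm_unit k n (G : 'M[F]_n) :
  G \in unitmx -> skew_norm k G \in unitmx.
Proof.
move=> uG; elim: k => [|k IHk]; first exact: unitmx1.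
by rewrite skew_normS unitmx_mul iter_map_mx_unit uG.
Qed.

End Norm.

(** * Galois descent over a finite field *)

Section Descent.

Variables (F : finFieldType) (sigma : {rmorphism F -> F}) (q r : nat).
Hypotheses (r_gt0 : (0 < r)%N) (cardF : #|F| = (q ^ r)%N).
Hypothesis sigmaE : forall x, sigma x = x ^+ q.

Lemma iter_sigmaE k x : iter k sigma x = x ^+ (q ^ k).
Proof. by elim: k => //= k ->; rewrite sigmaE -exprM -expnSr. Qed.

Lemma iter_sigma_order x : iter r sigma x = x.
Proof. by rewrite iter_sigmaE -cardF expf_card. Qed.

Lemma finField_has_prim_root : exists g : F, #|F|.-1.-primitive_root g.
Proof.
have lt1F : (1 < #|F|)%N by exact: finNzRing_gt1.
have n_gt0 : (0 < #|F|.-1)%N by rewrite -ltnS prednK // ltnW.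
pose rs := [seq x <- enum F | x != 0].
have/hasP[g _ prim_g] : has #|F|.-1.-primitive_root rs.
  apply: has_prim_root => //.
  - apply/allP => x; rewrite mem_filter => /andP[nz_x _].
    rewrite unity_rootE; apply/eqP/(mulfI nz_x).
    by rewrite -exprS prednK ?expf_card ?mulr1 // ltnW.
  - exact/filter_uniq/enum_uniq.
  - rewrite -(cardC1 (0 : F)) cardE /enum_mem /rs /enum_mem -filter_predI.
    rewrite leq_eqVlt; apply/orP; left; apply/eqP; congr size.
    by apply: eq_filter => x; rewrite /= ?andbT.
by exists g.
Qed.

(** A primitive root works: for [i < j < r] the exponents [q^i] and [q^j] differ by less than its
    order [q^r - 1]. *)
Lemma iter_sigma_separating : exists g : F, forall i j,
  (i < r)%N -> (j < r)%N -> iter i sigma g = iter j sigma g -> i = j.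
Proof.
have lt1F : (1 < #|F|)%N by exact: finNzRing_gt1.
(* A field has at least two elements, which excludes [q = 0] and [q = 1]. *)
have q_gt1 : (1 < q)%N.
  have := lt1F; rewrite cardF; case: q => [|[|//]].
    by rewrite exp0n.
  by rewrite exp1n.
have [g prim_g] := finField_has_prim_root.
exists g => i j; wlog le_ij : i j / (i <= j)%N => [IH|] lt_i lt_j.
  have [le_ij|lt_ji] := leqP i j; first exact: IH.
  by move/esym/(IH _ _ (ltnW lt_ji) lt_j lt_i).
rewrite !iter_sigmaE => /eqP; rewrite (eq_prim_root_expr prim_g) => eq_mod.
apply/eqP; rewrite eqn_leq le_ij leqNgt; apply/negP => lt_ij.
move: eq_mod; rewrite eq_sym eqn_mod_dvd ?leq_pexp2l ?(ltnW q_gt1) //.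
have lt_q : (q ^ j - q ^ i < #|F|.-1)%N.
  have qi_gt0 : (0 < q ^ i)%N by rewrite expn_gt0 ltnW.
  rewrite -subn1 cardF (leq_ltn_trans (leq_sub2l _ qi_gt0)) // ltn_sub2r //.
    by rewrite -[1%N](expn0 q) ltn_exp2l.
  by rewrite ltn_exp2l.
by rewrite gtnNdvd // subn_gt0 ltn_exp2l.
Qed.

Section FixedPoints.

Variables (m n : nat) (phi : 'M[F]_(m, n) -> 'M[F]_(m, n)).
Hypothesis phiD : {morph phi : A B / A + B}.
Hypothesis phiZ : forall c A, phi (c *: A) = sigma c *: phi A.
Variable V : {set 'M[F]_(m, n)}.
Hypothesis V_lin : forall c A B, A \in V -> B \in V -> c *: A + B \in V.
Hypothesis V_phi : forall A, A \in V -> phi A \in V.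
Hypothesis V_order : forall A, A \in V -> iter r phi A = A.

(* Galois descent: V is the extension of scalars to F of the F_q-space of its
   fixed points, because the Moore matrix of the powers of an element with r
   distinct conjugates is an invertible Vandermonde matrix. *)
Lemma card_semilinear_fixed : #|V| = (#|[set A in V | phi A == A]| ^ r)%N.
Proof.
have [V0|/set0Pn[A0 VA0]] := eqVneq V set0.
  rewrite V0 cards0; have -> : [set A in set0 | phi A == A] = set0.
    by apply/setP => A; rewrite !inE.
  by rewrite cards0 exp0n.
set W := [set A in V | phi A == A].
have V0 : 0 \in V by rewrite -(subrr A0) addrC -scaleN1r V_lin.
have V_sum (k : nat) (c : 'I_k -> F) (f : 'I_k -> 'M[F]_(m, n)) :
    (forall i, f i \in V) -> \sum_i c i *: f i \in V.
  move=> Vf; elim/big_rec: _ => [|i A _ VA]; first exact: V0.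
  exact: V_lin.
have phi0 : phi 0 = 0 by apply: (addrI (phi 0)); rewrite -phiD !addr0.
have iter_phi_sum j (k : nat) (c : 'I_k -> F) f :
    iter j phi (\sum_i c i *: f i)
    = \sum_i iter j sigma (c i) *: iter j phi (f i).
  elim: j => //= j ->; rewrite (big_morph _ phiD phi0).
  by apply: eq_bigr => i _; rewrite phiZ.
have V_iter A j : A \in V -> iter j phi A \in V.
  by move=> VA; elim: j => //= j; apply: V_phi.
have [g g_sep] := iter_sigma_separating.
pose M := Vandermonde r (\row_(j < r) iter j sigma g).
have uM : M \in unitmx.
  rewrite unitmxE unitfE det_Vandermonde; apply/prodf_neq0 => i _.
  apply/prodf_neq0 => j lt_ij; rewrite !mxE subr_eq0.
  apply: contraTneq lt_ij => /(g_sep _ _ (ltn_ord j) (ltn_ord i)) ->.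
  by rewrite ltnn.
have MN (i k : 'I_r) : \sum_j M i j * invmx M j k = (i == k)%:R.
  by have /matrixP/(_ i k) := mulmxV uM; rewrite !mxE.
have NM (i k : 'I_r) : \sum_j invmx M i j * M j k = (i == k)%:R.
  by have /matrixP/(_ i k) := mulVmx uM; rewrite !mxE.
have ME i (j : 'I_r) : M i j = iter j sigma (g ^+ i).
  rewrite /M !mxE; elim: (j : nat) => //= k; rewrite !iter_sigmaE => IHk.
  by rewrite !sigmaE -!exprM mulnC.
have sum_delta (f : 'I_r -> 'M[F]_(m, n)) k : \sum_i (i == k)%:R *: f i = f k.
  rewrite (bigD1 k) //= eqxx scale1r big1 ?addr0 // => i /negPf ->.
  by rewrite scale0r.
have cardW :
    #|[set u | u \in ffun_on W] : {set {ffun 'I_r -> _}}| = (#|W| ^ r)%N.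
  by rewrite cardsE card_ffun_on card_ord.
apply/eqP; rewrite eqn_leq -cardW; apply/andP; split.
  (* Entry [i] is the trace of [g^i A], the sum of its images under the powers of [phi]; inverting
     [M] recovers [phi^0 A = A]. *)
  pose f (A : 'M[F]_(m, n)) := [ffun i : 'I_r => \sum_j M i j *: iter j phi A].
  have inj_f : {in V &, injective f}.
    move=> A B VA VB eq_f; pose k := Ordinal r_gt0.
    suff fK C : \sum_i invmx M k i *: f C i = C by rewrite -(fK A) -(fK B) eq_f.
    under eq_bigr do rewrite ffunE scaler_sumr.
    rewrite exchange_big /= -[RHS](sum_delta (fun j => iter j phi C) k).
    apply: eq_bigr => j _; under eq_bigr do rewrite scalerA.
    by rewrite -scaler_suml NM eq_sym.
  rewrite -(card_in_imset inj_f).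
  apply/subset_leq_card/subsetP => _ /imsetP[A VA ->].
  rewrite inE; apply/ffun_onP => i; rewrite ffunE inE.
  rewrite V_sum => [|j]; last exact: V_iter.
  pose h j := iter j sigma (g ^+ i) *: iter j phi A.
  have -> : \sum_j M i j *: iter j phi A = \sum_(j < r) h j.
    by apply: eq_bigr => j _; rewrite ME.
  rewrite (big_morph _ phiD phi0).
  (* [phi] shifts the terms cyclically, since [h r = h 0]. *)
  rewrite (eq_bigr (fun j : 'I_r => h j.+1)); last by move=> j _; rewrite phiZ.
  apply/eqP; have : h r = h 0 by rewrite /h iter_sigma_order V_order.
  case: (r) => [|s] hs; first by rewrite !big_ord0.
  by rewrite big_ord_recr big_ord_recl /= hs addrC.
(* Reverse inequality: for fixed [u i], [phi^j] turns the coefficients [g^i] into [M i j], so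
   inverting [M] recovers [u]. *)
pose f (u : {ffun 'I_r -> 'M[F]_(m, n)}) := \sum_(i < r) g ^+ i *: u i.
have inj_f : {in [set u | u \in ffun_on W] &, injective f}.
  move=> u v; rewrite !inE => /ffun_onP Wu /ffun_onP Wv eq_f.
  have fK (w : {ffun 'I_r -> 'M[F]_(m, n)}) : (forall i, w i \in W) ->
      forall k, \sum_j invmx M j k *: iter j phi (f w) = w k.
    move=> Ww k; rewrite -[RHS](sum_delta w).
    under eq_bigr do rewrite iter_phi_sum scaler_sumr.
    rewrite exchange_big /=; apply: eq_bigr => i _.
    rewrite -MN scaler_suml; apply: eq_bigr => j _.
    rewrite scalerA mulrC -ME; congr (_ *: _).
    have /[!inE]/andP[_ /eqP phi_w] := Ww i.
    by elim: (j : nat) => //= l ->.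
  by apply/ffunP => k; rewrite -(fK u) // -(fK v) // eq_f.
rewrite -(card_in_imset inj_f).
apply/subset_leq_card/subsetP => _ /imsetP[u + ->].
rewrite inE => /ffun_onP Wu; apply: V_sum => i.
by have /[!inE]/andP[] := Wu i.
Qed.

End FixedPoints.

(** * Counting homomorphisms and surjections *)

Section Counting.

Variable n : nat.
Implicit Types G H K L A B : 'M[F]_n.

(** Descent for [phi A = G^-1 sigma(A) H]: its fixed points are the morphisms, and [phi^r A = A]
    says that [A] intertwines the norms. Stability of [L] makes [phi] preserve [A <= L]. *)
Lemma card_skew_hom G H L :
  G \in unitmx -> (map_mx sigma L *m H <= L)%MS ->
  (#|[set A | (skew_norm sigma r G *m A == A *m skew_norm sigma r H)
              && (A <= L)%MS]|
   = #|[set A : 'M[F]_n | (G *m A == map_mx sigma A *m H) && (A <= L)%MS]| ^ r)%N.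
Proof.
move=> uG stabL; pose phi A := invmx G *m map_mx sigma A *m H.
pose N := skew_norm sigma r; have uN : N n G \in unitmx by exact: skew_norm_unit.
have phiE A k : skew_norm sigma k G *m iter k phi A
    = iter k (map_mx sigma) A *m skew_norm sigma k H.
  elim: k => [|k IHk]; first by rewrite mulmx1 mul1mx.
  rewrite !skew_normSl !iterS {1}/phi.
  by rewrite !mulmxA mulmxK // -map_mxM IHk map_mxM.
have sigma_r A : iter r (map_mx sigma) A = A.
  by rewrite -map_mx_iter; apply/matrixP => i j; rewrite mxE iter_sigma_order.
have phi_r A : (N n G *m A == A *m N n H) = (iter r phi A == A).
  rewrite -[in X in _ == X](sigma_r A) -phiE.
  by rewrite (inj_eq (can_inj (mulKmx uN))) eq_sym.
rewrite (card_semilinear_fixed (phi := phi)).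
- congr (_ ^ _)%N; apply: eq_card => A; rewrite !inE phi_r.
  have -> : (phi A == A) = (G *m A == map_mx sigma A *m H).
    rewrite -(inj_eq (can_inj (mulKmx uG))) /phi !mulmxA mulmxV //.
    by rewrite mul1mx eq_sym.
  case: (G *m A =P _) => [GA|_]; last by rewrite andbF.
  have phiA : phi A = A by rewrite /phi -mulmxA -GA mulKmx.
  have -> : iter r phi A = A by elim: (r) => //= k ->.
  by rewrite eqxx andbT.
- by move=> A B; rewrite /phi map_mxD mulmxDr mulmxDl.
- by move=> c A; rewrite /phi map_mxZ -scalemxAr -scalemxAl.
- move=> c A B; rewrite !inE => /andP[/eqP NA AL] /andP[/eqP NB BL].
  rewrite mulmxDr mulmxDl -scalemxAr -scalemxAl NA NB eqxx /=.
  by rewrite addmx_sub ?scalemx_sub.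
- move=> A; rewrite !inE !phi_r => /andP[/eqP phiA AL].
  rewrite -iterSr iterS phiA eqxx /=.
  rewrite /phi -mulmxA mulmx_sub //; apply: submx_trans stabL.
  by rewrite submxMr ?map_submx.
- by move=> A; rewrite inE phi_r => /andP[/eqP].
Qed.

(** [A |-> B *m A] is a bijection between the intertwiners of norms and keeps row spaces inside [L];
    then take [r]-th roots of the cardinals. *)
Lemma card_skew_hom_eq G H B L :
  G \in unitmx -> H \in unitmx -> B \in unitmx ->
  skew_norm sigma r G *m B = B *m skew_norm sigma r H ->
  (map_mx sigma L *m H <= L)%MS ->
  #|[set A : 'M[F]_n | (G *m A == map_mx sigma A *m H) && (A <= L)%MS]|
  = #|[set A : 'M[F]_n | (H *m A == map_mx sigma A *m H) && (A <= L)%MS]|.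
Proof.
move=> uG uH uB NGB stabL; apply: (expIn r_gt0).
rewrite -!card_skew_hom //.
rewrite -[RHS](card_imset _ (can_inj (mulKmx uB))); apply: eq_card => A.
rewrite inE; apply/andP/imsetP=> [[/eqP NA AL]|[{}A + ->]].
  exists (invmx B *m A); last by rewrite mulKVmx.
  rewrite inE mulmx_sub // andbT -(inj_eq (can_inj (mulKmx uB))).
  by rewrite !mulmxA -NGB mulmxV // mul1mx mulmxK // NA.
rewrite inE => /andP[/eqP NA AL]; rewrite mulmx_sub //; split=> //.
by rewrite mulmxA NGB -!mulmxA NA.
Qed.

(* Hom(G, L) is the disjoint union of the Surj(G, K) over the submodules K of
   L, so counting homomorphisms amounts to counting surjections. *)
Lemma card_skew_surj_eq G H B K :
  G \in unitmx -> H \in unitmx -> B \in unitmx ->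
  skew_norm sigma r G *m B = B *m skew_norm sigma r H ->
  #|[set A : 'M[F]_n | (G *m A == map_mx sigma A *m H) && (<<A>>%MS == K)]|
  = #|[set A : 'M[F]_n | (H *m A == map_mx sigma A *m H) && (<<A>>%MS == K)]|.
Proof.
move=> uG uH uB NGB.
(* The image of a morphism is stable under [X], and [<<A>>] is the canonical matrix of its space;
   any other [K1] contributes 0. *)
have empty G1 K1 : ~~ ((<<K1>>%MS == K1) && (map_mx sigma K1 *m H <= K1)%MS) ->
    #|[set A : 'M[F]_n | (G1 *m A == map_mx sigma A *m H)
                         && (<<A>>%MS == K1)]| = 0.
  move=> badK; apply/eqP; rewrite cards_eq0; apply/set0Pn => -[A].
  rewrite inE => /andP[/eqP GA /eqP AK]; case/negP: badK.
  rewrite -AK genmx_id eqxx /= genmxE.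
  have /submx_trans-> // : (map_mx sigma <<A>>%MS *m H <= map_mx sigma A *m H)%MS.
    by rewrite submxMr // map_submx genmxE.
  by rewrite -GA submxMl.
have [m] := ubnP (\rank K); elim: m K => // m IHm K /ltnSE le_K.
have [/andP[/eqP genK stabK]|badK] := boolP ((<<K>>%MS == K)
    && (map_mx sigma K *m H <= K)%MS); last by rewrite !empty.
have homE G1 :
   #|[set A : 'M[F]_n | (G1 *m A == map_mx sigma A *m H) && (A <= K)%MS]|
   = (\sum_(K1 : 'M[F]_n | (K1 <= K)%MS)
       #|[set A : 'M[F]_n | (G1 *m A == map_mx sigma A *m H)
                            && (<<A>>%MS == K1)]|)%N.
  rewrite -sum1_card (partition_big (fun A => <<A>>%MS) (fun K1 => (K1 <= K)%MS)).
    apply: eq_bigr => K1 K1K; rewrite -sum1_card; apply: eq_bigl => A.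
    rewrite !inE -andbA; congr (_ && _); case: eqP => [AK|]; rewrite ?andbF //.
    by rewrite andbT -(genmxE A) AK.
  by move=> A; rewrite inE genmxE => /andP[].
have := card_skew_hom_eq uG uH uB NGB stabK; rewrite !homE.
(* Proper submodules have smaller rank, so their terms agree by induction and cancel. *)
rewrite (bigD1 K) ?submx_refl //= [RHS](bigD1 K) ?submx_refl //=.
rewrite [X in (_ + X = _)%N](eq_bigr (fun K1 => #|[set A : 'M[F]_n |
   (H *m A == map_mx sigma A *m H) && (<<A>>%MS == K1)]|)); first exact: addIn.
move=> K1 /andP[K1K neK1].
have [/andP[/eqP genK1 _]|badK1] := boolP ((<<K1>>%MS == K1)
    && (map_mx sigma K1 *m H <= K1)%MS); last by rewrite !empty.
apply: IHm; apply: leq_trans le_K; apply: rank_ltmx.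
rewrite /ltmx K1K /=; apply: contra neK1 => KK1.
by rewrite -genK1 -genK; apply/eqP/genmxP; rewrite K1K.
Qed.

Lemma semi_iso_of_norm G H B :
  G \in unitmx -> H \in unitmx -> B \in unitmx ->
  skew_norm sigma r G *m B = B *m skew_norm sigma r H -> semi_iso sigma G H.
Proof.
move=> uG uH uB NGB.
have := card_skew_surj_eq (<<1%:M : 'M[F]_n>>)%MS uG uH uB NGB => eq_card.
have : 1%:M \in [set A : 'M[F]_n | (H *m A == map_mx sigma A *m H)
    && (<<A>>%MS == <<1%:M : 'M[F]_n>>%MS)].
  by rewrite inE map_mx1 mul1mx mulmx1 !eqxx.
move=> in1; have /card_gt0P[A] : (0 < #|[set A : 'M[F]_n |
    (G *m A == map_mx sigma A *m H) && (<<A>>%MS == <<1%:M : 'M[F]_n>>%MS)]|)%N.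
  by rewrite eq_card; apply/card_gt0P; exists 1%:M.
rewrite inE => /andP[/eqP GA /eqP A1].
have uA : A \in unitmx by rewrite -row_full_unit -sub1mx -(genmxE A) A1 genmxE.
by exists A, (invmx A); rewrite mulmxV // mulVmx.
Qed.

End Counting.

End Descent.

(** * Splitting off the nilpotent part *)

Section LinearIsomorphism.

Variable F : fieldType.

Lemma mx_inverse_dim m n (A : 'M[F]_(m, n)) (B : 'M[F]_(n, m)) :
  A *m B = 1%:M -> B *m A = 1%:M -> m = n.
Proof.
move=> /mulmx1_min le_mn /mulmx1_min le_nm.
by apply/eqP; rewrite eqn_leq le_mn.
Qed.

(** Conjugacy is isomorphism for [sigma = idfun]; the transposes pass to the row convention. *)
Lemma mx_conjugate_trmx m n (M : 'M[F]_m) (N : 'M[F]_n) :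
  mx_conjugate M N <-> semi_iso idfun M^T N^T.
Proof.
split=> [[e]|[A [B [AB BA]]]].
  subst n; rewrite castmx_id => -[p up /(simmxP up) pM].
  exists p^T, (invmx p)^T; split.
  - by rewrite -trmx_mul mulVmx // trmx1.
  - by rewrite -trmx_mul mulmxV // trmx1.
  - by rewrite /skew_intertwines map_mx_id // -!trmx_mul pM.
have e := mx_inverse_dim AB BA; subst n.
rewrite /skew_intertwines map_mx_id => // MA.
have uA : A^T \in unitmx by rewrite unitmx_tr; case/mulmx1_unit: AB.
exists erefl; exists A^T => //; apply/simmxP => //; rewrite castmx_id.
by rewrite -[M]trmxK -[N]trmxK -!trmx_mul MA.
Qed.

(* Between a nilpotent block and an invertible one there is no nonzero
   intertwiner, so the invertible blocks correspond. *)
Lemma upper_intertwines_unit0 m n (N : 'M[F]_m) (U : 'M[F]_n) (B : 'M_(m, n)) :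
  (forall i j : 'I_m, (j <= i)%N -> N i j = 0) -> U \in unitmx ->
  N *m B = B *m U -> B = 0.
Proof.
move=> Nup uU NB.
have NkB k : iter k (mulmx N) B = iter k (mulmxr U) B.
  elim: k => //= k IHk; rewrite IHk; elim: k {IHk} => //= k IHk.
  by rewrite mulmxA IHk.
(* Each factor [N] strictly raises the row index that is read, so row [i] of [N^k B] vanishes once
   [i + k >= m]. *)
have Nk0 k (i : 'I_m) j : (m <= i + k)%N -> iter k (mulmx N) B i j = 0.
  elim: k i j => [|k IHk] i j; first by rewrite addn0 leqNgt ltn_ord.
  move=> le_m; rewrite /= mxE big1 // => l _; have [/Nup->|lt_il] := leqP l i.
    by rewrite mul0r.
  by rewrite IHk ?mulr0 // (leq_trans le_m) // addnS -addSn leq_add2r.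
have stop k : iter k (mulmxr U) B = 0 -> B = 0.
  elim: k => //= k IHk /(congr1 (mulmxr (invmx U))) /=.
  by rewrite mulmxK // mul0mx.
apply: (stop m); rewrite -NkB; apply/matrixP => i j.
by rewrite Nk0 ?leq_addl // mxE.
Qed.

(** The isomorphism and its inverse both have zero upper right block, so their diagonal blocks are
    mutually inverse. *)
Lemma semi_iso_unit_block m1 m2 n1 n2 (N1 : 'M[F]_m1) (U1 : 'M[F]_m2)
    (N2 : 'M[F]_n1) (U2 : 'M[F]_n2) :
  (forall i j : 'I_m1, (j <= i)%N -> N1 i j = 0) ->
  (forall i j : 'I_n1, (j <= i)%N -> N2 i j = 0) ->
  U1 \in unitmx -> U2 \in unitmx ->
  semi_iso idfun (block_mx N1 0 0 U1) (block_mx N2 0 0 U2) ->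
  m1 = n1 /\ semi_iso idfun U1 U2.
Proof.
move=> N1up N2up uU1 uU2 iso12; have [B [C [BC CB NB]]] := iso12.
have NC : block_mx N2 0 0 U2 *m C = C *m block_mx N1 0 0 U1.
  move: NB; rewrite /skew_intertwines map_mx_id // => NB.
  by rewrite -[LHS]mul1mx -CB -mulmxA (mulmxA B) -NB -!mulmxA BC mulmx1.
move: NB NC BC CB; rewrite /skew_intertwines map_mx_id //.
rewrite -[B]submxK -[C]submxK !mulmx_block !mul0mx !mulmx0 !addr0 !add0r.
rewrite !scalar_mx_block => /eq_block_mx[_ NB _ UB] /eq_block_mx[_ NC _ _].
rewrite (upper_intertwines_unit0 N1up uU2 NB).
rewrite (upper_intertwines_unit0 N2up uU1 NC).
rewrite !mul0mx !mulmx0 !addr0 !add0r.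
move=> /eq_block_mx[BC1 _ _ BC2] /eq_block_mx[CB1 _ _ CB2].
split; first exact: mx_inverse_dim BC1 CB1.
by exists (drsubmx B), (drsubmx C); rewrite /skew_intertwines map_mx_id.
Qed.

Variable sigma : {rmorphism F -> F}.

Lemma semi_iso_skew_norm r m n (G : 'M[F]_m) (H : 'M[F]_n) :
  (forall x, iter r sigma x = x) -> semi_iso sigma G H ->
  semi_iso idfun (skew_norm sigma r G) (skew_norm sigma r H).
Proof.
move=> sigma_r [A [B [AB BA GA]]]; exists A, B; split=> //.
rewrite /skew_intertwines map_mx_id // (skew_norm_intertwines _ GA).
by congr (_ *m _); rewrite -map_mx_iter; apply/matrixP => i j; rewrite mxE.
Qed.

Lemma semi_iso_block m1 m2 n1 n2 (G1 : 'M[F]_m1) (G2 : 'M[F]_m2)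
    (H1 : 'M[F]_n1) (H2 : 'M[F]_n2) :
  semi_iso sigma G1 H1 -> semi_iso sigma G2 H2 ->
  semi_iso sigma (block_mx G1 0 0 G2) (block_mx H1 0 0 H2).
Proof.
move=> [A1 [B1 [AB1 BA1 GA1]]] [A2 [B2 [AB2 BA2 GA2]]].
exists (block_mx A1 0 0 A2), (block_mx B1 0 0 B2).
rewrite /skew_intertwines map_block_mx !map_mx0 !mulmx_block.
rewrite !mul0mx !mulmx0 !addr0 !add0r AB1 BA1 AB2 BA2 GA1 GA2.
by rewrite !(scalar_mx_block _ _ (1 : F)); split.
Qed.

Lemma skew_norm_block k m n (G : 'M[F]_m) (H : 'M[F]_n) :
  skew_norm sigma k (block_mx G 0 0 H)
  = block_mx (skew_norm sigma k G) 0 0 (skew_norm sigma k H).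
Proof.
elim: k => [|k IHk]; first by rewrite /skew_norm /= scalar_mx_block.
rewrite !skew_normSl IHk map_block_mx !map_mx0 mulmx_block.
by rewrite !mul0mx !mulmx0 !addr0 !add0r.
Qed.

(** The offset [0 < k] separates the identity, at [k = 0], from the later norms, whose diagonal also
    vanishes. *)
Lemma skew_norm_upper k n (G : 'M[F]_n) :
  (forall i j : 'I_n, (j <= i)%N -> G i j = 0) ->
  forall i j : 'I_n, (j < i + (0 < k))%N -> skew_norm sigma k G i j = 0.
Proof.
move=> Gup; elim: k => [|k IHk] i j lt_ji.
  by rewrite mxE eq_sym -val_eqE ltn_eqF //= -(addn0 i).
rewrite skew_normSl mxE big1 // => l _; rewrite mxE.
have [lt_li|le_il] := ltnP l i.
  by rewrite IHk ?rmorph0 ?mul0r // ltn_addr.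
by rewrite addn1 ltnS in lt_ji; rewrite Gup ?mulr0 // (leq_trans lt_ji).
Qed.

(** [P] is the characteristic polynomial of its companion matrix, so its constant term is the
    determinant up to sign. *)
Lemma companionmx_unit (P : {poly F}) :
  P \is monic -> P`_0 != 0 -> companionmx P \in unitmx.
Proof.
move=> P_monic; rewrite -{1}(companionmxK P_monic) char_poly_det.
by rewrite mulf_eq0 negb_or unitmxE unitfE => /andP[].
Qed.

Lemma companionmxXn_upper e (i j : 'I_(size ('X^e : {poly F})).-1) :
  (j <= i)%N -> companionmx ('X^e : {poly F}) i j = 0.
Proof.
move=> le_ji; rewrite mxE; case: eqP => _; last first.
  by rewrite gtn_eqF.
have := ltn_ord j; rewrite {2}size_polyXn /= coefXn => /ltn_eqF->.
by rewrite oppr0.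
Qed.

End LinearIsomorphism.

(** * The Fitting decomposition of a cyclic module *)

Section NilpotentPart.

Variables (F : fieldType) (sigma : {rmorphism F -> F}).
Local Notation S := (skew_poly sigma).

(* The skew product on the left, the commutative one on the right. *)
Lemma skew_mulrXn (p : S) e :
  (p * ('X^e : {poly F}) : S) = (p : {poly F}) * 'X^e.
Proof.
rewrite -[LHS]/(skew_mul sigma p 'X^e) /skew_mul.
rewrite -[in RHS](coefK (p : {poly F})) poly_def mulr_suml.
apply: eq_bigr => i _; rewrite -scalerAl -exprD.
by rewrite -(iter_skew_mulX1 sigma e) -iterD iter_skew_mulX1.
Qed.

(** Coefficient [k] of [p W] is [p_k sigma^k(W_0)] plus terms in the [p_i] with [i < k], zero by
    induction. *)
Lemma skew_mulXn_coef0 (p W : S) e : (W : {poly F})`_0 != 0 ->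
  (forall k, (k < e)%N -> (p * W : S)`_k = 0) ->
  forall k, (k < e)%N -> (p : {poly F})`_k = 0.
Proof.
move=> nzW pW0 k; have [m] := ubnP k.
elim: m k => // m IHm k /ltnSE le_km lt_ke.
have := pW0 k lt_ke; rewrite coef_skew_mul big_ord_recr /= big1 => [|i _].
  rewrite add0r subnn => /eqP.
  rewrite mulf_eq0 iter_rmorph_eq0 (negPf nzW) orbF.
  by move/eqP.
by rewrite IHm ?mul0r // ?(leq_trans _ le_km) // (ltn_trans _ lt_ke).
Qed.

Variables (P P1 P2 : S) (e : nat).
Hypotheses (P_monic : (P : {poly F}) \is monic).
Hypotheses (P1_monic : (P1 : {poly F}) \is monic).
Hypothesis P2_0 : (P2 : {poly F})`_0 != 0.
Hypothesis PE1 : P = P1 * ('X^e : {poly F}).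
Hypothesis PE2 : P = iter e (skew_mulX sigma) P2.

(* S / SP = S P2 / SP + S X^e / SP, with summands S / S X^e and S / S P1. *)
Lemma companion_nil_unit_iso :
  semi_iso sigma
    (block_mx (companionmx ('X^e : {poly F})) 0 0 (companionmx (P1 : {poly F})))
    (companionmx (P : {poly F})).
Proof.
set GP := companionmx (P : {poly F}).
pose act := @skew_act F sigma _ GP.
pose X : S := ('X^e : {poly F}).
have X_monic : (X : {poly F}) \is monic by exact: monicXn.
pose w2 := act P2 (poly_rV 1); pose wX := act X (poly_rV 1).
have XP2 : X * P2 = P.
  by have := skew_mul_monl sigma 1 e P2; rewrite !scale1r -PE2 => XE; exact: XE.
have P1X : P1 * X = P := esym PE1.
have Xw2 : act X w2 = 0 by rewrite /w2 /act -skew_actM XP2 skew_act_companion.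
have P1wX : act P1 wX = 0 by rewrite /wX /act -skew_actM P1X skew_act_companion.
pose A := col_mx (krylov X GP w2) (krylov P1 GP wX).
apply: (@semi_iso_of_free _ _ _ _ _ _ A).
- rewrite /skew_intertwines mul_block_col !mul0mx addr0 add0r.
  rewrite map_col_mx mul_col_mx.
  by congr col_mx; apply: krylov_intertwines.
- rewrite PE1 skew_mulrXn size_mulXn ?monic_neq0 // size_polyXn /=.
  by rewrite -subn1 -addnBA ?subn1 // size_poly_gt0 monic_neq0.
(* A relation [v1 P2 + v2 X^e = c P1 X^e] makes [v1 P2] a left multiple of [X^e]. Hence [v1 = 0],
   then [v2 = c P1] has class 0. *)
move=> v; rewrite -[v]hsubmxK; set v1 := lsubmx v; set v2 := rsubmx v.
rewrite mul_row_col !mul_krylov -!skew_actM -skew_actDl.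
case/(skew_act_one_eq0 P_monic) => c; rewrite PE1 mulrA => /(canRL (addrK _)).
rewrite -mulrBl => v1P2.
have v1_coef k : (k < e)%N -> (rVpoly v1)`_k = 0.
  apply: (@skew_mulXn_coef0 (rVpoly v1) P2 e P2_0) => {}k lt_k.
  by rewrite v1P2 skew_mulrXn coefMXn lt_k.
have v1_0 : v1 = 0.
  apply/rowP => i; rewrite [RHS]mxE -coef_rVpoly_ord v1_coef //.
  by have := ltn_ord i; rewrite {2}size_polyXn.
move/eqP: v1P2; rewrite v1_0 linear0 mul0r eq_sym => cP1.
have nzX : X != 0 by exact: monic_neq0.
have cP1v : c * P1 = rVpoly v2.
  apply/eqP; rewrite -subr_eq0; apply: contraTT cP1 => nz_diff.
  exact: skew_mul_neq0.
rewrite -[v2](@skew_act_rVpoly _ sigma P1) -cP1v.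
by rewrite skew_actM skew_act_companion // skew_act0r row_mx0.
Qed.

End NilpotentPart.

(** * From conjugate norms to isomorphic modules *)

Section Conjugacy.

Variables (F : finFieldType) (sigma : {rmorphism F -> F}) (q r : nat).
Hypotheses (r_gt0 : (0 < r)%N) (cardF : #|F| = (q ^ r)%N).
Hypothesis sigmaE : forall x, sigma x = x ^+ q.
Local Notation S := (skew_poly sigma).

(** [e] is the multiplicity of the root 0; [X^e] on the right multiplies as in the commutative
    ring. *)
Lemma companion_fitting (P : S) : (P : {poly F}) \is monic ->
  exists e (P1 : {poly F}), companionmx P1 \in unitmx /\
    semi_iso sigma
      (block_mx (companionmx ('X^e : {poly F})) 0 0 (companionmx P1))
      (companionmx (P : {poly F})).
Proof.
move=> P_monic; have [e [P1 P1_0]] := multiplicity_XsubC (P : {poly F}) 0.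
rewrite subr0 => PE.
have {}P1_0 : P1`_0 != 0.
  by rewrite -horner_coef0; move: P1_0; rewrite monic_neq0.
have P1_monic : P1 \is monic by rewrite -(monicMr _ (monicXn _ e)) -PE.
exists e, P1; split; first exact: companionmx_unit.
have coef_iter k j : (iter k (map_poly sigma) P1)`_j = iter k sigma P1`_j.
  by elim: k => //= k <-; rewrite coef_map.
(* Moving [X^e] to the left requires [sigma^(-e)] on coefficients, which is [sigma^(e(r-1))] since
   [sigma^r = 1]. *)
pose P2 := iter (e * r.-1) (map_poly sigma) P1.
apply: (@companion_nil_unit_iso _ _ P P1 P2) => //.
- by rewrite coef_iter iter_rmorph_eq0.
- by rewrite [RHS]skew_mulrXn.
apply/polyP => i; rewrite PE coef_iter_skew_mulX coefMXn; case: ifP => // _.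
rewrite coef_iter -iterD -mulnS prednK //; move: P1`_(i - e) => x.
elim: e {PE P2} => //= e IHe.
by rewrite mulSn iterD -IHe (iter_sigma_order cardF).
Qed.

Lemma semi_iso_norm_unit m n (G : 'M[F]_m) (H : 'M[F]_n) :
  G \in unitmx -> H \in unitmx ->
  semi_iso idfun (skew_norm sigma r G) (skew_norm sigma r H) ->
  semi_iso sigma G H.
Proof.
move=> uG uH [B [C [BC CB]]]; have e := mx_inverse_dim BC CB; subst n.
rewrite /skew_intertwines map_mx_id // => NB.
apply: (semi_iso_of_norm r_gt0 cardF sigmaE uG uH _ NB).
by case/mulmx1_unit: BC.
Qed.

(** For the converse, both modules are split: the nilpotent blocks have equal size, hence coincide,
    and descent handles the invertible ones. *)
Lemma semi_iso_companion_norm (P Q : S) :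
  (P : {poly F}) \is monic -> (Q : {poly F}) \is monic ->
  semi_iso sigma (companionmx (P : {poly F})) (companionmx (Q : {poly F})) <->
  semi_iso idfun (skew_norm sigma r (companionmx (P : {poly F})))
                 (skew_norm sigma r (companionmx (Q : {poly F}))).
Proof.
move=> P_monic Q_monic; have sigma_r := iter_sigma_order cardF sigmaE.
split; first exact: semi_iso_skew_norm.
have [e [P1 [uP isoP]]] := companion_fitting P_monic.
have [f [Q1 [uQ isoQ]]] := companion_fitting Q_monic.
(* Here [r > 0] matters: the norm for [r = 0] is the identity. *)
have upper k : forall i j : 'I_(size ('X^k : {poly F})).-1,
    (j <= i)%N -> skew_norm sigma r (companionmx ('X^k : {poly F})) i j = 0.
  move=> i j le_ji; apply: skew_norm_upper; first exact: companionmxXn_upper.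
  by rewrite r_gt0 addn1 ltnS.
move=> /(semi_iso_trans (semi_iso_skew_norm sigma_r isoP)).
move=> /semi_iso_trans/(_ (semi_iso_sym (semi_iso_skew_norm sigma_r isoQ))).
rewrite !skew_norm_block.
case/(semi_iso_unit_block (upper e) (upper f)) => [||];
  try exact: skew_norm_unit.
rewrite !size_polyXn /= => ef iso1; subst f.
apply: semi_iso_trans (semi_iso_sym isoP) _; apply: semi_iso_trans isoQ.
by apply: semi_iso_block (semi_iso_refl _ _) (semi_iso_norm_unit _ _ iso1).
Qed.

End Conjugacy.

Theorem proposition2p1p8 (p a r : nat) (F : finFieldType)
    (p_prime : prime p) (r_gt0 : (0 < r)%N)
    (cardF : #|F| = ((p ^ a) ^ r)%N)
    (sigma : {rmorphism F -> F}) (sigmaE : forall x : F, sigma x = x ^+ (p ^ a))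
    (P Q : skew_poly sigma)
    (P_monic : (P : {poly F}) \is monic) (Q_monic : (Q : {poly F}) \is monic) :
  skew_similar P Q <->
  mx_conjugate (sigma_norm sigma r (skew_companion P))
               (sigma_norm sigma r (skew_companion Q)).
Proof.
have normE := semi_iso_companion_norm r_gt0 cardF sigmaE P_monic Q_monic.
have conjE := mx_conjugate_trmx (sigma_norm sigma r (skew_companion P))
  (sigma_norm sigma r (skew_companion Q)).
rewrite !trmx_sigma_norm in conjE; split=> [simPQ|].
  (* Similarity of [P] and [Q] yields a map from [S / S Q] to [S / S P], hence the symmetry. *)
  apply/conjE/normE/semi_iso_sym.
  exact: skew_similar_semi_iso simPQ.
move/conjE/normE/semi_iso_sym; exact: semi_iso_skew_similar.
Qed.
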